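(* Let $M_1\neq M_2$ be two distinct monomial ideals in $\mathbb{K}[x_1,\dots,x_n]$. There is at most one primitive vector $c\in\mathbb{Z}^n$ having both positive and negative coordinates such that the scheme $\Omega_c(M_1,M_2)$ is non-empty. Moreover, if $\Omega_c(M_1,M_2)\neq\emptyset$ for such a $c$, then for every primitive vector $c'\in\mathbb{Z}^n$ having both positive and negative coordinates, $M_1$ and $M_2$ have equal Hilbert functions with respect to the induced $(\mathbb{Z}^n/\mathbb{Z}c')$-grading if and only if $c'=\pm c$.
   Context: $\mathbb{K}$ is a field, $\mathbb{K}[\mathbf{x}]=\mathbb{K}[x_1,\dots,x_n]$, $\mathbb{N}=\{0,1,2,\dots\}$. A vector $c\in\mathbb{Z}^n$ is primitive if the greatest common divisor of its coordinates is $1$. Let $c\in\mathbb{Z}^n$ have at least one positive and at least one negative coordinate, and write $c=c^+-c^-$ for its positive and negative parts. The $(\mathbb{Z}^n/\mathbb{Z}c)$-grading of the polynomial ring gives $\mathbf{x}^u$ the degree $u+\mathbb{Z}c$; its Hilbert function for a homogeneous ideal $I$ sends a degree $a$ to $\dim_{\mathbb{K}}(\mathbb{K}[\mathbf{x}]/I)_a$. For a term order $\prec$ write $c\prec 0$ if $\mathbf{x}^{c^+}\prec\mathbf{x}^{c^-}$ and $c\succ 0$ otherwise. The initial ideal of a $(\mathbb{Z}^n/\mathbb{Z}c)$-homogeneous ideal $I$ depends only on which of $c\prec0$, $c\succ0$ holds, and is denoted $\mathrm{in}_{c\prec 0}(I)$ or $\mathrm{in}_{c\succ 0}(I)$ accordingly.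 For a monomial ideal $M$, the Schubert scheme $\Omega_c(M)$ is the affine $\mathbb{K}$-scheme parametrizing all $(\mathbb{Z}^n/\mathbb{Z}c)$-homogeneous ideals $I$ with $\mathrm{in}_{c\prec 0}(I)=M$. That is, it represents the functor sending a commutative $\mathbb{K}$-algebra $R$ to the set of $(\mathbb{Z}^n/\mathbb{Z}c)$-homogeneous ideals $I\subseteq R[\mathbf{x}]$ such that (i) for every monomial $\mathbf{x}^u\in M$ the ideal $I$ contains a polynomial of the form $\mathbf{x}^u+\sum_{i\ge1}\lambda_i\mathbf{x}^{u+ic}$ with $\lambda_i\in R$ (sum over $i$ with $u+ic\in\mathbb{N}^n$), and (ii) $I$ contains no nonzero $R$-linear combination of monomials not in $M$. For $R$ a field this says exactly $\mathrm{in}_{c\prec0}(I)=M$. For monomial ideals $M_1,M_2$ put $\Omega_c(M_1,M_2):=\Omega_c(M_1)\cap\Omega_{-c}(M_2)$ (scheme-theoretic intersection): it parametrizes the $(\mathbb{Z}^n/\mathbb{Z}c)$-homogeneous ideals $I$ with $\mathrm{in}_{c\prec0}(I)=M_1$ and $\mathrm{in}_{c\succ0}(I)=M_2$. It is non-empty if and only if such an ideal exists in $L[\mathbf{x}]$ for some field extension $L/\mathbb{K}$. *)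

(* Defs.v *)
From mathcomp Require Export all_boot all_order all_algebra.
From mathcomp Require Export boolp classical_sets.
From mathcomp Require Export mpoly.

Set Implicit Arguments.
Unset Strict Implicit.
Unset Printing Implicit Defensive.

Import Order.TTheory GRing.Theory Num.Theory.

Local Open Scope classical_set_scope.
Local Open Scope ring_scope.

(* ring_quotient's idealr_closed only covers proper, boolean ideals; the unit
   ideal is allowed here. *)
Definition is_ideal (R : comNzRingType) (I : set R) : Prop :=
  [/\ I 0, (forall f g, I f -> I g -> I (f + g))
    & (forall f g, I g -> I (f * g))].

Definition ideal_span (R : comNzRingType) (S : set R) : set R :=
  [set f | exists2 s : seq (R * R),
     (forall p, p \in s -> S p.2) & f = \sum_(p <- s) p.1 * p.2].

Definition monomial_ideal (R : comNzRingType) (n : nat)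
    (M : set {mpoly R[n]}) : Prop :=
  exists G : set 'X_{1..n},
    M = ideal_span [set 'X_[m] | m in G].

Definition mvec (n : nat) (m : 'X_{1..n}) : 'rV[int]_n :=
  \row_i (m i)%:Z.

Definition primitive (n : nat) (c : 'rV[int]_n) : Prop :=
  \big[gcdz/0]_(i < n) c 0 i = 1.

Definition mixed_sign (n : nat) (c : 'rV[int]_n) : Prop :=
  (exists i, 0 < c 0 i) /\ (exists i, c 0 i < 0).

(* An element a + Zc of the grading group Z^n/Zc is given by any of its
   representatives a : 'rV[int]_n; the notions below depend only on the class
   of a. *)
Definition homog_of_degree (R : comNzRingType) (n : nat) (c a : 'rV[int]_n) :
    set {mpoly R[n]} :=
  [set f | forall m, m \in msupp f -> exists k : int, mvec m = a + k *: c].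

Definition homogeneous_ideal (R : comNzRingType) (n : nat) (c : 'rV[int]_n)
    (I : set {mpoly R[n]}) : Prop :=
  is_ideal I /\
  I = ideal_span [set f | I f /\ exists a, homog_of_degree c a f].

(* The dimension of (K[x]/I)_a is d: a family of d homogeneous polynomials of
   degree a is a basis modulo I. When c has mixed signs each degree contains
   finitely many monomials, so exactly one d qualifies. *)
Definition hilbert_value (K : fieldType) (n : nat) (c : 'rV[int]_n)
    (I : set {mpoly K[n]}) (a : 'rV[int]_n) (d : nat) : Prop :=
  exists b : 'I_d -> {mpoly K[n]},
    [/\ (forall i, homog_of_degree c a (b i)),
        (forall l : 'I_d -> K, I (\sum_i l i *: b i) -> forall i, l i = 0)
      & (forall f, homog_of_degree c a f ->
           exists l : 'I_d -> K, I (f - \sum_i l i *: b i))].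

Definition same_hilbert_function (K : fieldType) (n : nat) (c : 'rV[int]_n)
    (I J : set {mpoly K[n]}) : Prop :=
  forall a d, hilbert_value c I a d <-> hilbert_value c J a d.

(* The R-points of Omega_c(M). Only the ring underlying the K-algebra R enters;
   M is a monomial ideal over K, used through the monomials it contains. *)
Definition schubert (K : fieldType) (n : nat) (c : 'rV[int]_n)
    (M : set {mpoly K[n]}) (R : comNzRingType) : set (set {mpoly R[n]}) :=
  [set I | [/\ homogeneous_ideal c I,
     (forall u : 'X_{1..n}, M 'X_[u] ->
        exists g, [/\ I g, g@_u = 1
          & forall v, v \in msupp g -> v != u ->
              exists2 i : nat, (0 < i)%N & mvec v = mvec u + i%:Z *: c])
   & (forall f, I f -> (forall m, m \in msupp f -> ~ M 'X_[m]) -> f = 0)]].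

Arguments schubert {K n} c M R.

Definition schubert2 (K : fieldType) (n : nat) (c : 'rV[int]_n)
    (M1 M2 : set {mpoly K[n]}) (R : comNzRingType) : set (set {mpoly R[n]}) :=
  schubert c M1 R `&` schubert (- c) M2 R.

Arguments schubert2 {K n} c M1 M2 R.

(* A K-scheme is non-empty iff it has a point over some field extension of K,
   of arbitrary (possibly infinite) degree. *)
Definition schubert2_nonempty (K : fieldType) (n : nat) (c : 'rV[int]_n)
    (M1 M2 : set {mpoly K[n]}) : Prop :=
  exists (L : fieldType) (iota : {rmorphism K -> L}),
    schubert2 c M1 M2 L !=set0.

(* Main.v *)
Require Import Defs.
From mathcomp Require Import zify ring.

Set Implicit Arguments.
Unset Strict Implicit.
Unset Printing Implicit Defensive.

Import Order.TTheory GRing.Theory Num.Theory.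

Local Open Scope classical_set_scope.
Local Open Scope ring_scope.

(** Only the sets of monomials of [M1] and [M2] matter, and everything happens
    along the lines [b + Z c] of the lattice, which meet the orthant [N^n] in
    finitely many points because [c] has mixed signs.

    If an ideal [I] lies in [Omega_c(M1, M2)], then [I] contains, for each
    monomial [u] of [M1], an element [g_u] with initial term [u] and all other
    terms further along [c]. For the [u] in a tail of a line, the [g_u] are
    independent and supported on that tail. Reduction modulo [I] to the standard
    monomials of [M2] shows that the tail has at least as many monomials of [M2]
    as of [M1] (schubert2_dominated). The opposite tails satisfy the opposite
    inequality, since [Omega_c(M1, M2) = Omega_(-c)(M2, M1)]; so whole lines
    have equal counts, which is equality of the Hilbert functions for [c] and [-c]
    (balanced_same_hilbert). If also [Omega_(-c)(M1, M2)] is non-empty, the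
    inequality holds on all tails in both directions, the counts on tails agree,
    and [M1 = M2]; hence the sign of [c] is determined.

    Suppose now that the Hilbert functions agree for a primitive
    [c' <> c, -c]. Then [c] and [c'] are independent. Pick a monomial [a] in
    exactly one of the two ideals and look at the plane [a + Z c + Z c'], with
    rows parallel to [c] and columns parallel to [c']. The column through
    [a + N c] and the one through [a - N c] cannot both meet the orthant when
    [N] is large (exists_empty_column); by symmetry let the first one miss it.
    Count the monomials of each ideal in the strip of columns [t, ..., N - 1].
    Columns are whole lines for [c'], so both ideals have the same total. The
    row pieces are tails of lines for [c], or empty because the row lies beyond
    the empty column, so on each of them [M1] has at most as many monomials as
    [M2]. Hence both counts agree on every row piece, and comparing [t = 0] with
    [t = 1] on the row of [a] shows that [a] is in both ideals or in neither
    (eq_at_of_empty_column). *)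

(** * Lattice points of the orthant on a line *)

Definition nonneg (n : nat) (a : 'rV[int]_n) : bool := [forall i, 0 <= a 0 i].

(** The inverse of [mvec] on the orthant; the absolute values give it a junk
    value elsewhere, which [nonneg] guards against. *)
Definition mnm_of (n : nat) (a : 'rV[int]_n) : 'X_{1..n} :=
  [multinom absz (a 0%R i) | i < n].

Lemma nonneg_mvec (n : nat) (m : 'X_{1..n}) : nonneg (mvec m).
Proof. by apply/forallP => i; rewrite mxE. Qed.

Lemma mvecK (n : nat) : cancel (@mvec n) (@mnm_of n).
Proof. by move=> m; apply/mnmP => i; rewrite mnmE mxE absz_nat. Qed.

Lemma mnm_ofK (n : nat) (a : 'rV[int]_n) : nonneg a -> mvec (mnm_of a) = a.
Proof.
by move=> /forallP a0; apply/rowP => i; rewrite mxE mnmE gez0_abs.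
Qed.

(** The orthant is convex. *)
Lemma nonneg_between (n : nat) (b c : 'rV[int]_n) (k l m : int) :
  k <= l <= m -> nonneg (b + k *: c) -> nonneg (b + m *: c) ->
  nonneg (b + l *: c).
Proof.
move=> /andP[kl lm] /forallP bk /forallP bm; apply/forallP => i.
move: (bk i) (bm i); rewrite !mxE; have [ci|/ltW ci] := leP 0 (c 0 i).
  by move=> /le_trans + _; apply; rewrite lerD2l ler_wpM2r.
by move=> _ /le_trans; apply; rewrite lerD2l ler_wnM2r.
Qed.

Definition norm1 (n : nat) (a : 'rV[int]_n) : nat := (\sum_i absz (a 0%R i))%N.

Lemma absz_le_norm1 (n : nat) (a : 'rV[int]_n) i :
  (absz (a 0%R i) <= norm1 a)%N.
Proof. by rewrite /norm1 (bigD1 i) //= leq_addr. Qed.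

Lemma norm1_line (n : nat) (a c : 'rV[int]_n) (k : nat) :
  (norm1 (a + k%:Z *: c) <= norm1 a + k * norm1 c)%N.
Proof.
rewrite /norm1 big_distrr -big_split /=; apply: leq_sum => i _; rewrite !mxE.
move: (a _ i) (c _ i) => x y; nia.
Qed.

(** A coordinate where [c] is positive bounds [k] from below and one where it is
    negative bounds it from above: this is the finiteness of the fibres of the
    [Z^n/Zc]-grading, in a form that is uniform in the base point. *)
Lemma mixed_sign_bound (n : nat) (a c : 'rV[int]_n) (k : int) :
  mixed_sign c -> nonneg (a + k *: c) -> (`|k| <= norm1 a)%N.
Proof.
move=> [[i ci] [j cj]] /forallP ak.
apply: (@leq_trans (maxn (absz (a 0%R i)) (absz (a 0%R j)))); last first.
  by rewrite geq_max !absz_le_norm1.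
move: ci cj (ak i) (ak j); rewrite !mxE.
move: (a 0 i) (a 0 j) (c 0 i) (c 0 j) => x z y w y0 w0 hx hz.
by have [k0|k0] := leP 0 k; nia.
Qed.

Lemma mixed_signN (n : nat) (c : 'rV[int]_n) : mixed_sign c -> mixed_sign (- c).
Proof.
by case=> [[i ci] [j cj]]; split; [exists j|exists i];
  rewrite mxE ?oppr_gt0 ?oppr_lt0.
Qed.

Lemma line_inj (n : nat) (b c : 'rV[int]_n) (k l : int) :
  mixed_sign c -> b + k *: c = b + l *: c -> k = l.
Proof.
move=> [[i ci] _] /addrI /rowP /(_ i); rewrite !mxE => /mulIf; apply.
by rewrite gt_eqF.
Qed.

(** * Monomial ideals and counts of their monomials on lines *)

Lemma monomial_ideal_ideal (R : comNzRingType) (n : nat)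
    (M : set {mpoly R[n]}) : monomial_ideal M -> is_ideal M.
Proof.
case=> G ->; split.
- by exists [::] => //; rewrite big_nil.
- move=> _ _ [s sG ->] [t tG ->]; exists (s ++ t); last by rewrite big_cat.
  by move=> p; rewrite mem_cat => /orP[/sG|/tG].
- move=> f _ [s sG ->]; exists [seq (f * p.1, p.2) | p <- s].
    by move=> _ /mapP[p ps ->]; exact: (sG p ps).
  by rewrite big_map mulr_sumr; apply: eq_bigr => p _; rewrite mulrA.
Qed.

Lemma monomial_ideal_msupp (R : comNzRingType) (n : nat)
    (M : set {mpoly R[n]}) (f : {mpoly R[n]}) : monomial_ideal M ->
  M f <-> (forall m, m \in msupp f -> M 'X_[m]).
Proof.
move=> hM; have [M0 MD MM] := monomial_ideal_ideal hM; split; last first.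
  move=> fM; rewrite [f]mpolyE big_seq; apply: (big_ind M) => // m /fM Mm.
  by rewrite -mul_mpolyC; apply: MM.
case: hM MM => G MG MM; rewrite {1}MG => -[s sG ->] m.
rewrite mcoeff_msupp linear_sum /=.
have [/hasP[p ps pm] _|/hasPn no] :=
  boolP (has (fun p => (p.1 * p.2)@_m != 0) s);
  last by rewrite big_seq big1 ?eqxx // => p /no; rewrite negbK => /eqP.
have [g Gg pg] := sG p ps.
have [u um] : exists u, m = (g + u)%MM.
  move: pm; rewrite -mcoeff_msupp -pg => /msuppM_le /allpairsP[[u v] /= [_]].
  by rewrite msuppX inE => /eqP -> ->; exists u; rewrite addmC.
rewrite um mpolyXD mulrC; apply: MM; rewrite MG; exists [:: (1, 'X_[g])].
  by move=> q; rewrite inE => /eqP ->; exists g.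
by rewrite big_seq1 mul1r.
Qed.

Definition mem_at (K : fieldType) (n : nat) (M : set {mpoly K[n]})
    (a : 'rV[int]_n) : bool :=
  nonneg a && `[< M 'X_[mnm_of a] >].

Lemma mem_at_mvec (K : fieldType) (n : nat) (M : set {mpoly K[n]}) m :
  mem_at M (mvec m) = `[< M 'X_[m] >].
Proof. by rewrite /mem_at nonneg_mvec mvecK. Qed.

Lemma eq_of_mem_at (K : fieldType) (n : nat) (M1 M2 : set {mpoly K[n]}) :
  monomial_ideal M1 -> monomial_ideal M2 ->
  (forall a, mem_at M1 a = mem_at M2 a) -> M1 = M2.
Proof.
move=> hM1 hM2 e; apply/seteqP; split=> f.
  move=> /(monomial_ideal_msupp _ hM1) fM; apply/(monomial_ideal_msupp _ hM2).
  by move=> m /fM /asboolP; rewrite -mem_at_mvec e mem_at_mvec => /asboolP.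
move=> /(monomial_ideal_msupp _ hM2) fM; apply/(monomial_ideal_msupp _ hM1).
by move=> m /fM /asboolP; rewrite -mem_at_mvec -e mem_at_mvec => /asboolP.
Qed.

Definition line_count (K : fieldType) (n : nat) (M : set {mpoly K[n]})
    (b c : 'rV[int]_n) (len : nat) : nat :=
  (\sum_(i < len) mem_at M (b + i%:Z *: c))%N.

Lemma line_countS (K : fieldType) (n : nat) (M : set {mpoly K[n]})
    (b c : 'rV[int]_n) (len : nat) :
  line_count M b c len.+1 = (mem_at M b + line_count M (b + c)%R c len)%N.
Proof.
rewrite /line_count big_ord_recl /= scale0r addr0; congr addn.
apply: eq_bigr => i _; congr (nat_of_bool (mem_at M _)).
by rewrite -addrA -[in RHS](scale1r c) scalerA -scalerDl mulr1 /bump /= -intS.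
Qed.

Lemma line_count_rev (K : fieldType) (n : nat) (M : set {mpoly K[n]})
    (b c : 'rV[int]_n) (len : nat) :
  line_count M b c len.+1 = line_count M (b + len%:Z *: c) (- c) len.+1.
Proof.
rewrite /line_count (reindex_inj rev_ord_inj) /=; apply: eq_bigr => i _.
congr (nat_of_bool (mem_at M _)).
rewrite scalerN -scaleNr -addrA -scalerDl subSS subzn //.
by rewrite -ltnS.
Qed.

Lemma line_count_card (K : fieldType) (n : nat) (M : set {mpoly K[n]})
    (b c : 'rV[int]_n) (len : nat) :
  line_count M b c len = #|[set i : 'I_len | mem_at M (b + i%:Z *: c)]%SET|.
Proof.
rewrite /line_count -sum1_card [RHS]big_mkcond /=; apply: eq_bigr => i _.
by rewrite inE; case: mem_at.
Qed.

(** A finite [len] beyond which the line has left the orthant makes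
    [line_count] count a whole tail. *)
Definition dominated (K : fieldType) (n : nat) (c : 'rV[int]_n)
    (M1 M2 : set {mpoly K[n]}) : Prop :=
  forall b len,
    (forall i : nat, (len <= i)%N -> ~~ nonneg (b + i%:Z *: c)) ->
    (line_count M1 b c len <= line_count M2 b c len)%N.

(** The bound on [k] says that the [len] points from [b] on exhaust the
    intersection of the line with the orthant, in both directions. *)
Definition balanced (K : fieldType) (n : nat) (c : 'rV[int]_n)
    (M1 M2 : set {mpoly K[n]}) : Prop :=
  forall b len,
    (forall k : int, nonneg (b + k *: c) -> 0 <= k < len%:Z) ->
    line_count M1 b c len = line_count M2 b c len.

(** A segment containing the whole intersection with the orthant is a tail for
    [c] and, read backwards, a tail for [- c]. *)
Lemma dominated_balanced (K : fieldType) (n : nat) (c : 'rV[int]_n)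
    (M1 M2 : set {mpoly K[n]}) :
  dominated c M1 M2 -> dominated (- c) M2 M1 -> balanced c M1 M2.
Proof.
move=> dom12 dom21 b [|len] inside; first by rewrite /line_count !big_ord0.
apply/eqP; rewrite eqn_leq dom12 /= => [|i li].
  rewrite (line_count_rev M1) (line_count_rev M2); apply: dom21 => i li.
  rewrite scalerN -scaleNr -addrA -scalerDl; apply/negP => /inside; lia.
by apply/negP => /inside; lia.
Qed.

(** All tails have equal counts, and removing its first point from a tail leaves
    a tail. *)
Lemma dominated_antisym (K : fieldType) (n : nat) (c a : 'rV[int]_n)
    (M1 M2 : set {mpoly K[n]}) :
  mixed_sign c -> dominated c M1 M2 -> dominated c M2 M1 ->
  mem_at M1 a = mem_at M2 a.
Proof.
move=> cm dom12 dom21.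
have tails b len :
    (forall i : nat, (len <= i)%N -> ~~ nonneg (b + i%:Z *: c)) ->
    line_count M1 b c len = line_count M2 b c len.
  by move=> out; apply/eqP; rewrite eqn_leq dom12 ?dom21.
have out (i : nat) : (norm1 a < i)%N -> ~~ nonneg (a + i%:Z *: c).
  by move=> ai; apply/negP => /(mixed_sign_bound cm) /=; rewrite leqNgt ai.
have := tails a (norm1 a).+1 out; rewrite !line_countS.
rewrite (tails (a + c)) => [/addIn|i ai]; first by do 2!case: mem_at.
by rewrite -addrA -{1}(scale1r c) -scalerDl -intS; apply: out.
Qed.

(** * Points of the Schubert scheme give domination *)

(** A homogeneous system with more unknowns than equations has a nonzero
    solution. *)
Lemma exists_left_kernel (F : fieldType) (p q : nat) (G : 'I_p -> 'I_q -> F) :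
  (q < p)%N ->
  exists2 w : 'I_p -> F, (exists i, w i != 0) &
    forall j, \sum_i w i * G i j = 0.
Proof.
move=> qp; pose A := \matrix_(i, j) G i j.
have : kermx A != 0.
  rewrite -mxrank_eq0 mxrank_ker -lt0n subn_gt0.
  exact: leq_ltn_trans (rank_leq_col A) qp.
case/rowV0Pn => v /sub_kermxP vA vn0.
exists (fun i => v 0 i).
  by case/rV0Pn: vn0 => i; exists i.
move=> j; move/rowP/(_ j): vA; rewrite !mxE => vA; rewrite -[RHS]vA.
by apply: eq_bigr => i _; rewrite mxE.
Qed.

Lemma is_ideal_comb (R : comNzRingType) (n : nat) (I : set {mpoly R[n]})
    (p : nat) (w : 'I_p -> R) (g : 'I_p -> {mpoly R[n]}) :
  is_ideal I -> (forall i, I (g i)) -> I (\sum_i w i *: g i).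
Proof.
move=> [I0 ID IM] Ig; apply: (big_ind I) => // i _.
by rewrite -mul_mpolyC; apply: IM.
Qed.

(** If the tail had more monomials of [M1] than of [M2], some nontrivial
    combination of the elements of [I] with those initial terms would have zero
    coefficient at all the monomials of [M2] of the tail. Its support, contained
    in the tail, would be standard for [M2], so it would vanish; but its first
    nonzero weight survives as a coefficient. *)
Lemma schubert2_dominated (K : fieldType) (n : nat) (c : 'rV[int]_n)
    (M1 M2 : set {mpoly K[n]}) :
  mixed_sign c -> schubert2_nonempty c M1 M2 -> dominated c M1 M2.
Proof.
move=> cm [L [_ [I [[[I_id _] lead1 _] [_ _ std2]]]]] b len out.
pose pt (i : nat) := b + i%:Z *: c.
rewrite !line_count_card leqNgt; apply/negP => lt21.
set Y := finset _ in lt21; set X := finset _ in lt21.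
have pt_inj : injective pt by move=> i j /(line_inj cm) [].
have /choice[g gP] (k : 'I_#|X|) : exists g : {mpoly L[n]},
    [/\ I g, g@_(mnm_of (pt (enum_val k))) = 1
      & forall v, v \in msupp g ->
          exists2 i : nat, (enum_val k <= i)%N & mvec v = pt i].
  have := enum_valP k; rewrite inE => /andP[nn /asboolP M1k].
  have [g [Ig g1 gs]] := lead1 _ M1k.
  exists g; split=> // v vg.
  have [->|vu] := eqVneq v (mnm_of (pt (enum_val k))).
    by exists (enum_val k) => //; rewrite mnm_ofK.
  have [i _ ->] := gs v vg vu; exists (enum_val k + i)%N; first exact: leq_addr.
  by rewrite mnm_ofK // /pt -addrA -scalerDl -PoszD.
have [w [k0 wk0] wG] := exists_left_kernel
  (fun k (j : 'I_#|Y|) => (g k)@_(mnm_of (pt (enum_val j)))) lt21.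
pose f := \sum_k w k *: g k.
have fE m : f@_m = \sum_k w k * (g k)@_m.
  by rewrite /f linear_sum; apply: eq_bigr => k _; exact: linearZ.
have f0 : f = 0.
  apply: std2 => [|m mf M2m].
    by apply: is_ideal_comb => // k; case: (gP k).
  have [k mk] : exists k, m \in msupp (g k).
    apply/existsP; apply: contraLR mf => /existsPn mg.
    rewrite mcoeff_msupp negbK fE big1 // => k _.
    by rewrite memN_msupp_eq0 ?mulr0.
  have [_ _ /(_ m mk) [i _ mi]] := gP k.
  have ilen : (i < len)%N.
    by rewrite ltnNge; apply/negP => /out; rewrite -/(pt i) -mi nonneg_mvec.
  have iY : Ordinal ilen \in Y.
    by rewrite inE /= -/(pt i) -mi mem_at_mvec; apply/asboolP.
  move: mf; rewrite mcoeff_msupp fE => /negP; apply; apply/eqP.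
  have := wG (enum_rank_in iY (Ordinal ilen)).
  by rewrite enum_rankK_in //= -mi mvecK.
(* Among the [g l] with nonzero weight, the one that starts first is the only one
   whose support contains its initial monomial. *)
case: (@arg_minnP _ k0 (fun k => w k != 0) (fun k => enum_val k)) => //.
move=> k wk kmin.
move/eqP: wk; apply.
have := fE (mnm_of (pt (enum_val k))).
rewrite f0 mcoeff0 (bigD1 k) //= big1 ?addr0 => [|l lk].
  by have [_ -> _] := gP k; rewrite mulr1.
have [->|wl] := eqVneq (w l) 0; first by rewrite mul0r.
rewrite memN_msupp_eq0 ?mulr0 //; apply/negP => kl.
have [_ _ /(_ _ kl) [i li]] := gP l.
have := enum_valP k; rewrite inE => /andP[nn _].
rewrite mnm_ofK // => /pt_inj ki.
move/negP: lk; apply; apply/eqP/enum_val_inj/val_inj/eqP.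
by rewrite eqn_leq kmin // andbT /= ki.
Qed.

Lemma schubert2_nonemptyN (K : fieldType) (n : nat) (c : 'rV[int]_n)
    (M1 M2 : set {mpoly K[n]}) :
  schubert2_nonempty c M1 M2 -> schubert2_nonempty (- c) M2 M1.
Proof.
by move=> [L [io [I [I1 I2]]]]; exists L, io, I; split => //; rewrite opprK.
Qed.

(** * Hilbert functions of monomial ideals *)

(** Steinitz exchange modulo [I], without forming the quotient: too many
    elements, written in terms of the generators, satisfy a linear relation. *)
Lemma hilbert_value_le (K : fieldType) (n : nat) (c : 'rV[int]_n)
    (I : set {mpoly K[n]}) (a : 'rV[int]_n) (d e : nat) :
  is_ideal I -> hilbert_value c I a d -> hilbert_value c I a e -> (e <= d)%N.
Proof.
move=> Iid [b [_ _ bgen]] [b' [b'hom b'free _]].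
rewrite leqNgt; apply/negP => de.
have /choice[l lP] i := bgen _ (b'hom i).
have [w [i wi] wl] := exists_left_kernel l de.
move/eqP: wi; apply; apply: b'free.
suff -> : \sum_i w i *: b' i = \sum_i w i *: (b' i - \sum_j l i j *: b j).
  exact: is_ideal_comb.
under [RHS]eq_bigr do rewrite scalerBr.
rewrite sumrB; apply/esym/subr0_eq; rewrite addrAC subrr add0r.
under eq_bigr do rewrite scaler_sumr.
rewrite exchange_big /= big1 ?oppr0 // => j _.
under eq_bigr do rewrite scalerA.
by rewrite -scaler_suml wl scale0r.
Qed.

Lemma hilbert_value_inj (K : fieldType) (n : nat) (c : 'rV[int]_n)
    (I : set {mpoly K[n]}) (a : 'rV[int]_n) (d e : nat) :
  is_ideal I -> hilbert_value c I a d -> hilbert_value c I a e -> d = e.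
Proof.
move=> Iid hd he; apply/eqP; rewrite eqn_leq.
by rewrite (hilbert_value_le Iid he hd) (hilbert_value_le Iid hd he).
Qed.

Definition line_size (n : nat) (b c : 'rV[int]_n) (len : nat) : nat :=
  (\sum_(i < len) nonneg (b + i%:Z *: c))%N.

Lemma line_count_le_size (K : fieldType) (n : nat) (M : set {mpoly K[n]})
    (b c : 'rV[int]_n) (len : nat) :
  (line_count M b c len <= line_size b c len)%N.
Proof.
by apply: leq_sum => i _; rewrite /mem_at; case: nonneg => //; case: asbool.
Qed.

(** The standard monomials of degree [b] form a basis modulo [M], since
    membership in [M] is decided monomial by monomial; the bound on [k] puts all
    monomials of degree [b] on the segment. *)
Lemma hilbert_value_monomial (K : fieldType) (n : nat) (M : set {mpoly K[n]})
    (b c : 'rV[int]_n) (len : nat) :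
  monomial_ideal M -> mixed_sign c ->
  (forall k : int, nonneg (b + k *: c) -> 0 <= k < len%:Z) ->
  hilbert_value c M b (line_size b c len - line_count M b c len)%N.
Proof.
move=> hM cm inside; pose pt (i : nat) := b + i%:Z *: c.
set Y := [set i : 'I_len | nonneg (pt i) && ~~ mem_at M (pt i)]%SET.
have -> : (line_size b c len - line_count M b c len)%N = #|Y|.
  apply/eqP; rewrite -(eqn_add2r (line_count M b c len)) subnK.
    rewrite -sum1_card big_mkcond /= -big_split /=; apply/eqP/eq_bigr => i _.
    by rewrite inE /mem_at /pt; case: nonneg => //=; case: asbool.
  exact: line_count_le_size.
have ptY (k : 'I_#|Y|) :
    nonneg (pt (enum_val k)) /\ ~ M 'X_[mnm_of (pt (enum_val k))].
  have := enum_valP k; rewrite inE => /andP[nn]; rewrite /mem_at nn /=.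
  by move/asboolP.
pose m (k : 'I_#|Y|) := mnm_of (pt (enum_val k)).
have m_inj : injective m.
  move=> k l /(congr1 (@mvec n)); rewrite !mnm_ofK;
    [|by case: (ptY l)|by case: (ptY k)].
  by move/(line_inj cm) => -[] /val_inj/enum_val_inj.
have coefE (l : 'I_#|Y| -> K) k : (\sum_i l i *: 'X_[m i])@_(m k) = l k.
  rewrite linear_sum (bigD1 k) //= big1 ?addr0 => [|i ik].
    by rewrite mcoeffZ mcoeffX eqxx mulr1.
  by rewrite mcoeffZ mcoeffX (inj_eq m_inj) (negPf ik) mulr0.
exists (fun k => 'X_[m k]); split.
- move=> k v; rewrite msuppX inE => /eqP ->; exists (enum_val k)%:Z.
  by rewrite mnm_ofK //; case: (ptY k).
- move=> l /(monomial_ideal_msupp _ hM) Ml k; apply/eqP/contraT => lk.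
  by have [_ []] := ptY k; apply: Ml; rewrite mcoeff_msupp coefE.
- move=> f fhom; exists (fun k => f@_(m k)).
  apply/(monomial_ideal_msupp _ hM) => v.
  rewrite mcoeff_msupp mcoeffB; have [[k ->]|vm] := pselect (exists k, v = m k).
    by rewrite coefE subrr eqxx.
  have vmk k : m k == v = false.
    by apply/negP => /eqP mv; apply: vm; exists k.
  rewrite linear_sum /= big1 => [|k _];
    last by rewrite mcoeffZ mcoeffX vmk mulr0.
  rewrite subr0 -mcoeff_msupp => /fhom[k vk]; apply: contrapT => Mv.
  have := nonneg_mvec v; rewrite vk => /[dup] nnk /inside /andP[k0 kl].
  case: k k0 kl vk nnk => // i _ ilen vi nni.
  have iY : Ordinal ilen \in Y.
    by rewrite inE /= /pt nni -vi mem_at_mvec /=; apply/asboolPn.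
  have := vmk (enum_rank_in iY (Ordinal ilen)).
  by rewrite /m enum_rankK_in //= /pt -vi mvecK eqxx.
Qed.

Lemma same_hilbert_balanced (K : fieldType) (n : nat) (c : 'rV[int]_n)
    (M1 M2 : set {mpoly K[n]}) :
  monomial_ideal M1 -> monomial_ideal M2 -> mixed_sign c ->
  same_hilbert_function c M1 M2 -> balanced c M1 M2.
Proof.
move=> hM1 hM2 cm same b len inside.
have := hilbert_value_inj (monomial_ideal_ideal hM2)
  ((same _ _).1 (hilbert_value_monomial hM1 cm inside))
  (hilbert_value_monomial hM2 cm inside).
have := line_count_le_size M1 b c len; have := line_count_le_size M2 b c len.
lia.
Qed.

(** The degrees [a] and [a + k c] are the same element of [Z^n/Zc]. *)
Lemma hilbert_value_translate (K : fieldType) (n : nat) (c a : 'rV[int]_n)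
    (I : set {mpoly K[n]}) (d : nat) (k : int) :
  hilbert_value c I (a + k *: c) d -> hilbert_value c I a d.
Proof.
have shift f l :
    homog_of_degree c (a + l *: c) f <-> @homog_of_degree K n c a f.
  split=> fa m /fa[j ->].
    by exists (l + j); rewrite -addrA -scalerDl.
  by exists (j - l); rewrite -addrA -scalerDl [l + _]addrC subrK.
case=> b [bh bf bg]; exists b; split=> // [i|f fa].
  exact/(shift _ k).
by apply: bg; apply/shift.
Qed.

Lemma balanced_same_hilbert (K : fieldType) (n : nat) (c : 'rV[int]_n)
    (M1 M2 : set {mpoly K[n]}) :
  monomial_ideal M1 -> monomial_ideal M2 -> mixed_sign c ->
  balanced c M1 M2 -> same_hilbert_function c M1 M2.
Proof.
move=> hM1 hM2 cm bal a d; pose B := norm1 a.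
pose b := a - B%:Z *: c.
have inside (k : int) : nonneg (b + k *: c) -> 0 <= k < (B + B).+1%:Z.
  rewrite /b addrAC -scaleNr -addrA -scalerDl => /(mixed_sign_bound cm).
  rewrite -/B; lia.
have hv (M : set {mpoly K[n]}) : monomial_ideal M ->
    hilbert_value c M a
      (line_size b c (B + B).+1 - line_count M b c (B + B).+1)%N.
  move=> hM; apply: (@hilbert_value_translate _ _ _ _ _ _ (- B%:Z)).
  by rewrite scaleNr; apply: hilbert_value_monomial.
have h1 := hv _ hM1; have h2 := hv _ hM2; rewrite -(bal _ _ inside) in h2.
by split=> hd; [rewrite (hilbert_value_inj (monomial_ideal_ideal hM1) hd h1)
  | rewrite (hilbert_value_inj (monomial_ideal_ideal hM2) hd h2)].
Qed.

Lemma same_hilbertN (K : fieldType) (n : nat) (c : 'rV[int]_n)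
    (M1 M2 : set {mpoly K[n]}) :
  same_hilbert_function c M1 M2 -> same_hilbert_function (- c) M1 M2.
Proof.
have homN a f : homog_of_degree (- c) a f <-> @homog_of_degree K n c a f.
  by split=> fa m /fa[k ->]; exists (- k); rewrite ?scalerN scaleNr ?opprK.
have hvN I a d : hilbert_value (- c) I a d <-> @hilbert_value K n c I a d.
  by split=> -[b [bh bf bg]]; exists b; split=> // [i|f /homN]; try exact/homN;
    apply: bg.
by move=> same a d; split=> /hvN/same/hvN.
Qed.

(** * The plane spanned by two directions *)

Lemma big_gcdzM (n : nat) (m : int) (F : 'I_n -> int) :
  \big[gcdz/0]_(i < n) (m * F i) = `|m| * \big[gcdz/0]_(i < n) F i.
Proof.
elim/big_rec2: _ => [|i x y _ ->]; first by rewrite mulr0.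
by rewrite /gcdz !abszM absz_id -muln_gcdr PoszM abszE.
Qed.

(** Taking the gcd over [j] of the vanishing minors gives [|c_i| = |d_i|] for
    every [i]; one nonzero coordinate then fixes a common sign. *)
Lemma primitive_parallel (n : nat) (c d : 'rV[int]_n) :
  primitive c -> primitive d -> mixed_sign c ->
  (forall i j, c 0 i * d 0 j = c 0 j * d 0 i) -> d = c \/ d = - c.
Proof.
move=> cp dp [[i0 ci0] _] par.
have abs_eq i : `|c 0 i| = `|d 0 i|.
  have := big_gcdzM (c 0 i) (fun j => d 0 j); rewrite dp mulr1 => <-.
  have := big_gcdzM (d 0 i) (fun j => c 0 j); rewrite cp mulr1 => <-.
  by apply: eq_bigr => j _; rewrite par mulrC.
have ci0n : c 0 i0 != 0 by rewrite gt_eqF.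
have /eqP := abs_eq i0; rewrite eqr_norm2 => /orP[/eqP e|/eqP e]; [left|right];
  apply/rowP => j; rewrite ?mxE; apply: (mulfI ci0n); have := par i0 j.
  by rewrite -e => ->; rewrite mulrC.
by move=> ->; rewrite e mulrNN mulrC.
Qed.

(** If both columns met the orthant, at [p = a + N c + l d] and
    [q = a - N c + k d], then [p + q = 2a + (l + k) d] would lie in the orthant,
    which bounds [l + k] as [d] has mixed signs. So [p <= p + q] is bounded
    independently of [N], and so are the minors of [p - a] and [d]; but those
    are [N] times the minors of [c] and [d]. *)
Lemma exists_empty_column (n : nat) (a c d : 'rV[int]_n) i j :
  mixed_sign d -> c 0 i * d 0 j != c 0 j * d 0 i ->
  exists2 N : nat, (0 < N)%N &
    (forall l : int, ~~ nonneg (a + N%:Z *: c + l *: d)) \/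
    (forall l : int, ~~ nonneg (a + N%:Z *: - c + l *: d)).
Proof.
move=> dm cd.
pose s := norm1 (a + a); pose T := (s + s * norm1 d + norm1 a)%N.
pose N := (2 * (T * norm1 d)).+1.
exists N => //; apply: contrapT => /not_orP[].
move=> /existsNP[l /negP/negPn pl] /existsNP[k /negP/negPn qk].
set p := _ + l *: d in pl; set q := _ + k *: d in qk.
have pq : p + q = a + a + (l + k) *: d.
  by apply/rowP => h; rewrite !mxE; ring.
have lk : (absz (l + k)%R <= s)%N.
  apply: (mixed_sign_bound dm); rewrite -pq; apply/forallP => h.
  by rewrite mxE addr_ge0 //; [move/forallP: pl | move/forallP: qk].
have p_small h : `|p 0 h - a 0 h| <= T%:Z.
  have : p 0 h + q 0 h = a 0 h + a 0 h + (l + k) * d 0 h.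
    by rewrite /p /q !mxE; ring.
  have := absz_le_norm1 (a + a) h; rewrite mxE -/s.
  have := absz_le_norm1 a h; have := absz_le_norm1 d h; rewrite /T.
  move/forallP: pl => /(_ h); move/forallP: qk => /(_ h).
  have : (absz (l + k)%R * absz (d 0%R h) <= s * norm1 d)%N.
    by rewrite leq_mul // absz_le_norm1.
  rewrite -abszM; move: (p 0 h) (q 0 h) (_ * d 0 h) => x y z; lia.
have det : (p 0 i - a 0 i) * d 0 j - (p 0 j - a 0 j) * d 0 i
    = N%:Z * (c 0 i * d 0 j - c 0 j * d 0 i).
  by rewrite /p !mxE; ring.
have : `|N%:Z * (c 0 i * d 0 j - c 0 j * d 0 i)| <= (2 * (T * norm1 d))%N%:Z.
  rewrite -det (le_trans (ler_normB _ _)) // !normrM mul2n -addnn PoszD PoszM.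
  by apply: lerD; apply: ler_pM => //; rewrite -abszE lez_nat absz_le_norm1.
move: cd; rewrite -subr_eq0 -normr_gt0 normrM -/N.
move: `|_ - _| => D; rewrite /N; nia.
Qed.

(** Over the strip of columns [t, ..., N - 1], counting by rows gives [M1] at most
    as many monomials as [M2] and counting by columns gives equality, so the
    row of [a] has equal counts; then the strips for [t = 0] and [t = 1] differ
    on that row by the point [a] only. *)
Lemma eq_at_of_empty_column (K : fieldType) (n : nat) (c d a : 'rV[int]_n)
    (M1 M2 : set {mpoly K[n]}) (N : nat) :
  mixed_sign d -> dominated c M1 M2 -> balanced d M1 M2 ->
  (0 < N)%N -> (forall l : int, ~~ nonneg (a + N%:Z *: c + l *: d)) ->
  mem_at M1 a = mem_at M2 a.
Proof.
move=> dm dom bal N0 empty.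
(* [B] bounds the length of all columns meeting the strip, so that the rows
   [0, ..., 2B] cover them; row [B] is the one through [a]. *)
pose B := (norm1 a + N * norm1 c)%N.
pose row (t i : nat) := a + t%:Z *: c + (i%:Z - B%:Z) *: d.
have rows_eq t : (t <= N)%N ->
    line_count M1 (row t B) c (N - t) = line_count M2 (row t B) c (N - t).
  move=> tN.
  have row_le i : (line_count M1 (row t i) c (N - t)
      <= line_count M2 (row t i) c (N - t))%N.
    have hole : ~~ nonneg (row t i + (N - t)%N%:Z *: c).
      rewrite (_ : _ + _ = a + N%:Z *: c + (i%:Z - B%:Z) *: d) //.
      by rewrite -subzn //; apply/rowP => j; rewrite !mxE; ring.
    (* A row with a point of the orthant beyond the empty column has none before
       it, by convexity. *)
    have [[k Nk nnk]|beyond] := pselect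
        (exists2 k : nat, (N - t <= k)%N & nonneg (row t i + k%:Z *: c)).
      rewrite [line_count M1 _ _ _]big1 // => j _; rewrite /mem_at.
      case: (boolP (nonneg _)) => //= nnj; case/negP: hole.
      by apply: nonneg_between nnj nnk; rewrite !lez_nat Nk ltnW.
    by apply: dom => k Nk; apply/negP => nnk; apply: beyond; exists k.
  have cols : (\sum_(i < (B + B).+1) line_count M1 (row t i) c (N - t)
      = \sum_(i < (B + B).+1) line_count M2 (row t i) c (N - t))%N.
    rewrite /line_count exchange_big [RHS]exchange_big /=.
    apply: eq_bigr => k _; pose p := a + (t + k)%N%:Z *: c.
    have sumE (M : set {mpoly K[n]}) :
        (\sum_(i < (B + B).+1) mem_at M (row t i + k%:Z *: c)%R)%N
        = line_count M (p - B%:Z *: d) d (B + B).+1.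
      apply: eq_bigr => i _; congr (nat_of_bool (mem_at M _)).
      by rewrite /p /row PoszD; apply/rowP => j; rewrite !mxE; ring.
    rewrite !sumE; apply: bal => x.
    rewrite -scaleNr -addrA -scalerDl => /(mixed_sign_bound dm) xB.
    have pB : (norm1 p <= B)%N.
      rewrite (leq_trans (norm1_line _ _ _)) // leq_add2l leq_mul2r.
      by have := ltn_ord k; lia.
    lia.
  have Bl : (B < (B + B).+1)%N by rewrite ltnS leq_addr.
  (* Termwise inequalities with equal totals are equalities. *)
  have [_] := leqif_sum (fun (i : 'I_(B + B).+1) (_ : true) =>
    leqif_eq (row_le i)).
  by rewrite cols eqxx => /esym/forallP/(_ (Ordinal Bl))/eqP.
have := rows_eq 1%N N0; have := rows_eq 0%N (leq0n _).
rewrite /row subrr !scale0r !addr0 scale1r subn0 subn1.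
rewrite -(prednK N0) !line_countS.
by move=> + e1; rewrite e1 => /addIn; do 2!case: mem_at.
Qed.

Lemma same_hilbert_direction (K : fieldType) (n : nat) (c d : 'rV[int]_n)
    (M1 M2 : set {mpoly K[n]}) :
  monomial_ideal M1 -> monomial_ideal M2 -> M1 <> M2 ->
  primitive c -> mixed_sign c -> dominated c M1 M2 -> dominated (- c) M2 M1 ->
  primitive d -> mixed_sign d -> same_hilbert_function d M1 M2 ->
  d = c \/ d = - c.
Proof.
move=> hM1 hM2 hM12 cp cm dom12 dom21 dp dm same.
have bal := same_hilbert_balanced hM1 hM2 dm same.
apply: contrapT => ndc; apply: hM12; apply: eq_of_mem_at => // a.
have [i [j cd]] : exists i j, c 0 i * d 0 j != c 0 j * d 0 i.
  apply: contrapT => par; apply: ndc; apply: primitive_parallel => // i j.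
  by apply/eqP/contraT => cd; case: par; exists i, j.
have [N N0 [empty|empty]] := exists_empty_column a dm cd.
  exact: eq_at_of_empty_column dm dom12 bal N0 empty.
apply/esym/(eq_at_of_empty_column dm dom21 _ N0 empty) => b len inside.
exact/esym/bal.
Qed.

Theorem theorem8 (K : fieldType) (n : nat) (M1 M2 : set {mpoly K[n]})
    (hM1 : monomial_ideal M1) (hM2 : monomial_ideal M2) (hM12 : M1 <> M2) :
  (forall c c' : 'rV[int]_n,
     primitive c -> mixed_sign c -> schubert2_nonempty c M1 M2 ->
     primitive c' -> mixed_sign c' -> schubert2_nonempty c' M1 M2 ->
     c = c') /\
  (forall c : 'rV[int]_n,
     primitive c -> mixed_sign c -> schubert2_nonempty c M1 M2 ->
     forall c' : 'rV[int]_n, primitive c' -> mixed_sign c' ->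
       (same_hilbert_function c' M1 M2 <-> c' = c \/ c' = - c)).
Proof.
have dom (c : 'rV[int]_n) : mixed_sign c -> schubert2_nonempty c M1 M2 ->
    dominated c M1 M2 /\ dominated (- c) M2 M1.
  move=> cm ne; split; first exact: schubert2_dominated.
  exact/(schubert2_dominated (mixed_signN cm))/schubert2_nonemptyN.
have same (c : 'rV[int]_n) : mixed_sign c -> schubert2_nonempty c M1 M2 ->
    same_hilbert_function c M1 M2.
  move=> cm /(dom c cm)[d12 d21].
  by apply: balanced_same_hilbert => //; apply: dominated_balanced.
have direction (c d : 'rV[int]_n) : primitive c -> mixed_sign c ->
    schubert2_nonempty c M1 M2 -> primitive d -> mixed_sign d ->
    same_hilbert_function d M1 M2 -> d = c \/ d = - c.
  move=> cp cm /(dom c cm)[d12 d21] dp dm.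
  exact: (same_hilbert_direction hM1 hM2 hM12 cp cm d12 d21 dp dm).
split=> [c c' cp cm ne c'p c'm ne'|c cp cm ne c' c'p c'm].
  have [//|c'N] := direction c c' cp cm ne c'p c'm (same c' c'm ne').
  have [d12 _] := dom c cm ne; have [_] := dom c' c'm ne'.
  rewrite c'N opprK => d21; case: hM12.
  by apply: eq_of_mem_at => // a; apply: dominated_antisym cm d12 d21.
split; first exact: direction.
by case=> ->; [|apply: same_hilbertN]; apply: same.
Qed.
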